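(* Let $G$ be a minimally 3-connected graph of order $n\geq 7$ and let $\alpha \in [\frac{1}{2},1)$. Then $\rho_{\alpha}(G)\leq \rho_{\alpha}(W_n)$, with equality if and only if $G\cong W_n$.
   Context: All graphs are simple, finite and undirected. For a graph $G$ with adjacency matrix $A(G)$ and diagonal degree matrix $D(G)$, and real $\alpha\in[0,1]$, define $A_\alpha(G)=\alpha D(G)+(1-\alpha)A(G)$; its largest eigenvalue $\rho_\alpha(G)$ is called the $\alpha$-index of $G$. A graph is $k$-connected if removing fewer than $k$ vertices always leaves a connected graph; it is minimally $k$-connected if it is $k$-connected and deleting any edge leaves a graph that is not $k$-connected. $W_n=K_1\vee C_{n-1}$ is the wheel on $n$ vertices (a cycle on $n-1$ vertices plus one vertex adjacent to all of them). *)

(* Defs.v *)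
From HB Require Import structures.
From mathcomp Require Import all_boot all_order all_algebra.
From mathcomp Require Import classical_sets reals.
From mathcomp Require complex polyrcf.

Set Implicit Arguments.
Unset Strict Implicit.
Unset Printing Implicit Defensive.

Import Order.TTheory GRing.Theory Num.Theory.
Local Open Scope ring_scope.

Record sgraph := SGraph {
  vertex :> finType;
  adj : rel vertex;
  adj_sym : symmetric adj;
  adj_irrefl : irreflexive adj }.

Arguments adj {s} x y.

Definition degree (G : sgraph) (x : G) : nat := #|[set y | adj x y]|.

Section Deletion.
Variable G : sgraph.

Section Vertices.
Variable S : {set G}.

Definition del_vertices_adj : rel {x : G | x \notin S} :=
  fun x y => adj (val x) (val y).

Lemma del_vertices_sym : symmetric del_vertices_adj.
Proof. by move=> x y; rewrite /del_vertices_adj adj_sym. Qed.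

Lemma del_vertices_irrefl : irreflexive del_vertices_adj.
Proof. by move=> x; rewrite /del_vertices_adj adj_irrefl. Qed.

Definition del_vertices : sgraph := SGraph del_vertices_sym del_vertices_irrefl.
End Vertices.

Section Edge.
Variables x y : G.

Definition del_edge_adj : rel G :=
  fun u v => adj u v && ([set u; v] != [set x; y]).

Lemma del_edge_sym : symmetric del_edge_adj.
Proof. by move=> u v; rewrite /del_edge_adj adj_sym finset.setUC. Qed.

Lemma del_edge_irrefl : irreflexive del_edge_adj.
Proof. by move=> u; rewrite /del_edge_adj adj_irrefl. Qed.

Definition del_edge : sgraph := SGraph del_edge_sym del_edge_irrefl.
End Edge.

End Deletion.

Definition connected_graph (G : sgraph) : Prop :=
  (0 < #|G|)%N /\ forall x y : G, connect adj x y.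

Definition k_connected (k : nat) (G : sgraph) : Prop :=
  forall S : {set G}, (#|S| < k)%N -> connected_graph (del_vertices S).

Definition minimally_k_connected (k : nat) (G : sgraph) : Prop :=
  k_connected k G /\
  forall x y : G, adj x y -> ~ k_connected k (del_edge x y).

Definition isomorphic (G H : sgraph) : Prop :=
  exists2 f : G -> H, bijective f & forall x y, adj (f x) (f y) = adj x y.

Section Complete.
Variable n : nat.

Definition complete_adj : rel 'I_n := fun i j => i != j.

Lemma complete_sym : symmetric complete_adj.
Proof. by move=> i j; rewrite /complete_adj eq_sym. Qed.

Lemma complete_irrefl : irreflexive complete_adj.
Proof. by move=> i; rewrite /complete_adj eqxx. Qed.

Definition complete_graph : sgraph := SGraph complete_sym complete_irrefl.
End Complete.

Section Cycle.
Variable n : nat.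

(* [i != j] only matters for [n = 1], where [ordS i = i]. *)
Definition cycle_adj : rel 'I_n :=
  fun i j => (i != j) && ((j == ordS i) || (i == ordS j)).

Lemma cycle_sym : symmetric cycle_adj.
Proof. by move=> i j; rewrite /cycle_adj eq_sym orbC. Qed.

Lemma cycle_irrefl : irreflexive cycle_adj.
Proof. by move=> i; rewrite /cycle_adj eqxx. Qed.

Definition cycle_graph : sgraph := SGraph cycle_sym cycle_irrefl.
End Cycle.

Section Join.
Variables G H : sgraph.

Definition join_adj : rel (G + H)%type := fun u v =>
  match u, v with
  | inl x, inl y => adj x y
  | inr x, inr y => adj x y
  | _, _ => true
  end.

Lemma join_sym : symmetric join_adj.
Proof. by move=> [x|x] [y|y] //=; rewrite adj_sym. Qed.

Lemma join_irrefl : irreflexive join_adj.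
Proof. by move=> [x|x] /=; rewrite adj_irrefl. Qed.

Definition join_graph : sgraph := SGraph join_sym join_irrefl.
End Join.

Definition wheel (n : nat) : sgraph :=
  join_graph (complete_graph 1) (cycle_graph n.-1).

Lemma card_wheel n : (0 < n)%N -> #|wheel n| = n.
Proof. by case: n => // n _; rewrite card_sum !card_ord. Qed.

Section AlphaIndex.
Variables (R : realType) (alpha : R) (G : sgraph).

Definition adjacency_mx : 'M[R]_#|G| :=
  \matrix_(i, j) (adj (enum_val i) (enum_val j))%:R.

Definition degree_mx : 'M[R]_#|G| :=
  diag_mx (\row_i (degree (enum_val i))%:R).

Definition alpha_mx : 'M[R]_#|G| :=
  alpha *: degree_mx + (1 - alpha) *: adjacency_mx.

(* The supremum is a maximum for nonempty [G]: see [alpha_indexP]. *)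
Definition alpha_index : R := sup [set r | eigenvalue alpha_mx r]%classic.

Lemma alpha_mx_sym : alpha_mx^T = alpha_mx.
Proof.
rewrite /alpha_mx linearD !linearZ /= tr_diag_mx; congr (_ + _ *: _).
by apply/matrixP=> i j; rewrite !mxE adj_sym.
Qed.

End AlphaIndex.

Section SymmetricSpectrum.
Import complex.
Local Open Scope complex_scope.

Lemma sym_eigenvalue_ex (R : rcfType) n (A : 'M[R]_n) :
  (0 < n)%N -> A^T = A -> exists r, eigenvalue A r.
Proof.
move=> n_gt0 symA; pose f := @real_complex R.
pose B := map_mx f A.
have [c] : exists c, eigenvalue B c.
  have /closed_rootP[c rc] : size (char_poly B) != 1%N.
    by rewrite size_char_poly eqSS -lt0n.
  by exists c; rewrite eigenvalue_root_char.
move=> cB; have /eigenvalueP[v vB v0] := cB.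
pose N := v *m (map_mx Num.conj v)^T.
have herm (M : 'M_n) : map_mx Num.conj (M^T) = M ->
    map_mx Num.conj (v *m M *m (map_mx Num.conj v)^T)^T
    = v *m M *m (map_mx Num.conj v)^T.
  move=> hM; rewrite !trmx_mul trmxK !map_mxM hM mulmxA; congr (_ *m _ *m _).
    by rewrite -map_mx_comp map_mx_id // => x; exact: conjCK.
  by rewrite map_trmx.
have B_herm : map_mx Num.conj B^T = B.
  rewrite /B map_trmx symA -map_mx_comp; apply/eq_map_mx => x /=.
  by apply/CrealP; rewrite complex_real.
have I_herm : map_mx Num.conj (1%:M : 'M[R[i]]_n)^T = 1%:M.
  by rewrite trmx1 map_mx1.
have := herm _ I_herm; rewrite mulmx1 -/N => N_herm.
have := herm _ B_herm; rewrite vB -scalemxAl -/N linearZ /= map_mxZ N_herm.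
have N00 : N 0 0 != 0.
  rewrite mxE psumr_neq0; last by move=> i _; rewrite !mxE mul_conjC_ge0.
  have /rV0Pn[j vj] := v0; apply/hasP; exists j; first exact: mem_index_enum.
  by rewrite /= !mxE mul_conjC_gt0.
move=> /matrixP /(_ 0 0); rewrite mxE [RHS]mxE => /(mulIf N00) /CrealP.
move=> /complex_realP[r cE]; exists r.
move: cB; rewrite cE !eigenvalue_root_char.
by rewrite /B -map_char_poly fmorph_root.
Qed.

End SymmetricSpectrum.

Lemma alpha_indexP (R : realType) (alpha : R) (G : sgraph) : (0 < #|G|)%N ->
  eigenvalue (alpha_mx alpha G) (alpha_index alpha G) /\
  forall r, eigenvalue (alpha_mx alpha G) r -> r <= alpha_index alpha G.
Proof.
move=> G_gt0; rewrite /alpha_index; set A := alpha_mx alpha G.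
have [r0 r0A] := sym_eigenvalue_ex G_gt0 (alpha_mx_sym alpha G).
pose s := polyrcf.rootsR (char_poly A).
have sE r : eigenvalue A r = (r \in s).
  rewrite eigenvalue_root_char -[RHS]polyrcf.roots_on_rootsR //.
  exact/monic_neq0/char_poly_monic.
have [m mA mmax] : exists2 m, eigenvalue A m & forall r, eigenvalue A r -> r <= m.
  exists (\big[Num.max/r0]_(r <- s) r).
    rewrite big_seq; elim/big_ind: _ => // [x y xA yA|r]; last by rewrite sE.
    by case: (leP x y).
  by move=> r; rewrite sE => rs; exact: le_bigmax_seq.
have -> : sup [set r | eigenvalue A r]%classic = m; last by split.
apply/le_anti/andP; split; first by apply: ge_sup; [exists m | exact: mmax].
by apply: ub_le_sup => //; exists m => r; exact: mmax.
Qed.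

(* Main.v *)
Require Import Defs.
From mathcomp Require Import all_boot all_order all_algebra.
From mathcomp Require Import boolp reals.
From mathcomp Require Import zify ring lra.

(** In a minimally 3-connected graph [G] a triangle has at most one vertex of
    degree at least 4, so two adjacent vertices of degree at least 4 have no
    common neighbour and their degrees add up to at most [n].

    If all degrees are at most [n - 3], then [d x + d y <= n] on every edge, and
    the decomposition [A_alpha = (2 alpha - 1) D + (1 - alpha) (D + A)] gives
    [rho_alpha G <= (2 alpha - 1) (n - 3) + (1 - alpha) n], which is smaller than
    the larger root of the characteristic quadratic of the hub-rim quotient of
    the wheel.

    Otherwise some [v] has degree at least [n - 2], and all its neighbours have
    degree 3. Degree [n - 2] is impossible: with [u] the other non-neighbour of
    [v], the connected graph [G - u - v] would have too few edges. For degree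
    [n - 1], [G - v] is connected and 2-regular, hence a cycle. *)

Set Implicit Arguments.
Unset Strict Implicit.
Unset Printing Implicit Defensive.

Import Order.TTheory GRing.Theory Num.Theory.

(** * Cuts made of vertices and one edge, and degrees in triangles *)

Section Cuts.
Variable G : sgraph.
Implicit Types (S X P : {set G}) (x y z a b : G).

(** Otherwise [P] would be closed under adjacency in [G - S], against connectivity. *)
Lemma connected_del_crossing S P x y :
  connected_graph (del_vertices S) ->
  x \in P -> x \notin S -> y \notin P -> y \notin S ->
  exists a b, [/\ a \in P, a \notin S, b \notin P, b \notin S & adj a b].
Proof.
move=> [_ conn] xP xS yP yS; apply: contrapT => none.
pose Q : {pred del_vertices S} := [pred u | val u \in P].
have clQ : closed (@adj (del_vertices S)) Q.
  move=> [u uS] [v vS]; rewrite /adj /= /del_vertices_adj !inE /= => uv.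
  apply/idP/idP => [uP|vP]; apply: contrapT => /negP.
    by move=> vP; apply: none; exists u, v.
  by move=> uP; apply: none; exists v, u; rewrite adj_sym.
have := closed_connect clQ (conn (Sub x xS) (Sub y yS)).
by rewrite !inE /= xP (negPf yP).
Qed.

Lemma k_connected3_crossing P s t x y : k_connected 3 G ->
  x \in P -> x \notin [set s; t] -> y \notin P -> y \notin [set s; t] ->
  exists a b,
    [/\ a \in P, a \notin [set s; t], b \notin P, b \notin [set s; t] & adj a b].
Proof.
move=> conn; apply: connected_del_crossing; apply: conn.
by rewrite cards2; case: (_ != _).
Qed.

(** A mixed cut by vertices and one edge: [X] is a union of components of [G - S - xy], and the side
    named is the one containing [x]. *)
Definition edge_cut x y X S : Prop :=
  [/\ x \in X, y \notin X /\ y \notin S, forall a, a \in X -> a \notin S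
    & forall a b, a \in X -> b \notin X -> b \notin S -> adj a b ->
      a = x /\ b = y].

(** Some small [S] disconnects the graph once [xy] is deleted, but not before, so [xy] is a bridge
    of [G - S]. *)
Lemma minimally_k_connected_edge_cut k x y : minimally_k_connected k G -> adj x y ->
  exists X S, #|S| < k /\ edge_cut x y X S.
Proof.
move=> [conn mini] xy; have := mini _ _ xy => /existsNP[S /not_implyP[Sk disc]].
have connS := conn S Sk; pose H := del_vertices S.
have [a /existsNP[b nab]] : exists a : H, ~ forall b : H, connect adj a b.
  by apply/existsNP => h; apply: disc; split=> //; case: connS.
(* The component of [a] in [H], where [xy] is already missing; hence every edge of [G - S] leaving
   it is [xy]. *)
pose X : {set G} := [set val w | w in [set w : H | connect adj a w]].
have XS p : p \in X -> p \notin S by case/imsetP => [[w wS] _ ->].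
have cross p q : p \in X -> q \notin X -> q \notin S -> adj p q -> [set p; q] = [set x; y].
  move=> /imsetP[w]; rewrite inE => aw -> qX qS pq.
  apply/eqP; apply: contraNT qX => ne; apply/imsetP; exists (Sub q qS) => //.
  rewrite inE; apply: connect_trans aw (connect1 _).
  by apply/andP; split.
have aX : val a \in X by apply/imsetP; exists a; rewrite // inE connect0.
have bX : val b \notin X.
  apply/imsetP => -[w]; rewrite inE => aw /val_inj bw.
  by apply: nab; rewrite bw.
have [p [q [pX pS qX qS pq]]] :=
  connected_del_crossing connS aX (valP a) bX (valP b).
have /setP E := cross _ _ pX qX qS pq.
have : p \in [set x; y] by rewrite -E !inE eqxx.
have : q \in [set x; y] by rewrite -E !inE eqxx orbT.
have npq : p != q by apply: contraNneq qX => <-.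
rewrite !inE => /orP[]/eqP qE /orP[]/eqP pE; rewrite {}qE {}pE in npq pX pS qX qS pq E *.
- by rewrite eqxx in npq.
(* Here the edge leaves [X] from [y], so the side containing [x] is the opposite one. *)
- exists (~: X :\: S), S; split=> //; split=> //.
  + by rewrite !inE qX qS.
  + by rewrite !inE pX andbF pS.
  + by move=> c; rewrite inE => /andP[].
  move=> c d; rewrite !inE => /andP[cS cX]; rewrite negb_and !negbK => /orP[->//|dX] dS cd.
  have /setP E' := cross _ _ dX cX cS (etrans (adj_sym d c) cd).
  have := E' c; have := E' d; rewrite !inE !eqxx orbT /=.
  move=> /esym/orP[]/eqP dE; first by rewrite -dE dX in qX.
  by move=> /esym/orP[]/eqP cE; rewrite // cE pX in cX.
- exists X, S; split=> //; split=> // c d cX dX dS cd.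
  have /setP E' := cross _ _ cX dX dS cd.
  have := E' c; have := E' d; rewrite !inE !eqxx orbT /=.
  move=> /esym/orP[]/eqP dE; first by rewrite dE pX in dX.
  by move=> /esym/orP[]/eqP cE; rewrite // -cE cX in qX.
- by rewrite eqxx in npq.
Qed.

(** A singleton is covered by [t = z]. *)
Lemma set2_of_card_lt3 S z : z \in S -> #|S| < 3 -> exists t, S = [set z; t].
Proof.
move=> zS; rewrite (cardsD1 z) zS add1n !ltnS => S1.
have [S0|] := eqVneq (S :\ z) set0; first by exists z; rewrite -(setD1K zS) S0 setU0 setUid.
rewrite -card_gt0 => S0; have /cards1P[t tE] : #|S :\ z| == 1 by rewrite eqn_leq S1.
by exists t; rewrite -(setD1K zS) tE.
Qed.

(** The path [x z y] avoids the edge [xy], so only [z] can block it. *)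
Lemma common_neighbour_in_cut x y z X S : edge_cut x y X S ->
  adj x z -> adj y z -> z \in S.
Proof.
move=> [xX [yX yS] XS cross] xz yz; apply: contraT => zS.
case zX: (z \in X).
  have [zx _] := cross _ _ zX yX yS (etrans (adj_sym z y) yz).
  by rewrite zx adj_irrefl in xz.
have [_ zy] := cross _ _ xX (negbT zX) zS xz.
by rewrite zy adj_irrefl in yz.
Qed.

Lemma triangle_edge_cut x y z : minimally_k_connected 3 G ->
  adj x y -> adj x z -> adj y z -> exists X t, edge_cut x y X [set z; t].
Proof.
move=> mini xy xz yz.
have [X [S [S3 cut]]] := minimally_k_connected_edge_cut mini xy.
have zS := common_neighbour_in_cut cut xz yz.
by have [t SE] := set2_of_card_lt3 zS S3; exists X, t; rewrite -SE.
Qed.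

Lemma degree_gt3_neighbour x a b c : 3 < degree x ->
  exists w, [/\ adj x w, w != a, w != b & w != c].
Proof.
move=> d; have /subsetPn[w] : ~~ ([set w | adj x w] \subset [set a; b; c]).
  apply/negP => /subset_leq_card; rewrite leqNgt => /negP; apply.
  apply: leq_trans d; rewrite ltnS -[3]/(2 + 1).
  rewrite (leq_trans (leq_card_setU _ _)) // cards1 cards2.
  by case: (_ != _).
by rewrite !inE !negb_or => xw /andP[/andP[wa wb] wc]; exists w.
Qed.

(* The cuts [(X, {z, t})] of the edge [xy] and [(X', {y, t'})] of [xz] cross;
   uncrossing them forces [t] into [X'] and [t'] into [X], and then the part
   of [~: X] beyond [y] is cut off by two vertices. *)
Lemma triangle_degree_le3 x y z : minimally_k_connected 3 G ->
  adj x y -> adj x z -> adj y z -> 3 < degree x -> 3 < degree y -> False.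
Proof.
move=> mini xy xz yz dx dy; have conn := mini.1.
have [X [t [xX [yX yS] XS cX]]] := triangle_edge_cut mini xy xz yz.
have [X' [t' [xX' [zX' zS'] XS' cX']]] :=
  triangle_edge_cut mini xz xy (etrans (adj_sym z y) yz).
have neq u v : adj u v -> u != v.
  by move=> uv; apply: contraTneq uv => ->; rewrite adj_irrefl.
have xS := XS _ xX; have xS' := XS' _ xX'.
move: (yS) (zS') (xS) (xS'); rewrite !inE !negb_or => /andP[yz' yt] /andP[zy' zt'].
move=> /andP[xz' xt] /andP[xy' xt'].
have nbrX a b : a \in X -> a != x -> adj a b -> [\/ b \in X, b = z | b = t].
  move=> aX ax ab; case: (boolP (b \in X)) => bX; first by constructor 1.
  case: (boolP (b \in [set z; t])) => bS; last first.
    by have [E _] := cX _ _ aX bX bS ab; rewrite E eqxx in ax.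
  by move: bS; rewrite !inE => /orP[]/eqP; [constructor 2|constructor 3].
(* Otherwise every edge leaving [(X :&: X') :\ x] and avoiding [x] and [t'] would also leave [X']
   outside [{y, t'}], which only [xz] can do; so [{x, t'}] would separate [c] from [z]. *)
have tX' : t \in X'.
  apply: contraT => tX'.
  have [c [xc cy cz ct']] := degree_gt3_neighbour y z t' dx.
  have cX'in : c \in X'.
    apply: contraT => cX'n.
    have cS : c \notin [set y; t'] by rewrite !inE negb_or cy.
    by have [_ E] := cX' _ _ xX' cX'n cS xc; rewrite E eqxx in cz.
  have ct : c != t by apply: contraNneq tX' => <-.
  have cXin : c \in X.
    apply: contraT => cXn.
    have cS : c \notin [set z; t] by rewrite !inE negb_or cz.
    by have [_ E] := cX _ _ xX cXn cS xc; rewrite E eqxx in cy.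
  have cx : c != x by rewrite eq_sym neq.
  have [|||//|a [b []]] := @k_connected3_crossing ((X :&: X') :\ x) x t' c z conn.
  - by rewrite !inE cx cXin.
  - by rewrite !inE negb_or cx.
  - by rewrite !inE (negPf zX') !andbF.
  - by rewrite !inE negb_or eq_sym xz' zt'.
  rewrite !inE !negb_or => /and3P[ax aX aX'] _ bP /andP[bx bt'] ab.
  have bX' : b \notin X'.
    by case: (nbrX _ _ aX ax ab) => [bX|->|->] //; move: bP; rewrite bx bX.
  have bS' : b \notin [set y; t'].
    rewrite !inE negb_or bt' andbT.
    case: (nbrX _ _ aX ax ab) => [bX|->|->] //; try by rewrite eq_sym.
    by apply: contraNneq yX => <-.
  by have [E _] := cX' _ _ aX' bX' bS' ab; rewrite E eqxx in ax.
have := XS' _ tX'; rewrite !inE negb_or => /andP[_ tt'].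
have zt : z != t by apply: contraNneq zX' => ->.
(* Otherwise [{x, t}] would separate [(X :&: X') :\ x] from [z], so [X] meets [X'] only in [x]. An
   edge leaving [X :\ x] and avoiding [z] and [t'] then enters [X'] and must be [xz], which is
   impossible; so [{z, t'}] would separate [p] from [x]. *)
have t'X : t' \in X.
  apply: contraT => t'X.
  have [p [xp py pz pt]] := degree_gt3_neighbour y z t dx.
  have pX : p \in X.
    apply: contraT => pX.
    have pS : p \notin [set z; t] by rewrite !inE negb_or pz.
    by have [_ E] := cX _ _ xX pX pS xp; rewrite E eqxx in py.
  have px : p != x by rewrite eq_sym neq.
  have AX' c : c \in X -> c != x -> c \notin X'.
    move=> cXin cx; apply/negP => cX'in.
    have [|||//|a [b []]] := @k_connected3_crossing ((X :&: X') :\ x) x t c z conn.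
    - by rewrite !inE cx cXin.
    - by have := XS _ cXin; rewrite !inE !negb_or cx => /andP[].
    - by rewrite !inE (negPf zX') !andbF.
    - by rewrite !inE negb_or eq_sym xz' zt.
    rewrite !inE !negb_or => /and3P[ax aX aX'] _ bP /andP[bx bt] ab.
    have bX' : b \notin X'.
      case: (nbrX _ _ aX ax ab) => [bX|->|bE] //; first by move: bP; rewrite bx bX.
      by rewrite bE eqxx in bt.
    have bS' : b \notin [set y; t'].
      case: (nbrX _ _ aX ax ab) => [bX|->|bE] //; last by rewrite bE eqxx in bt.
      by rewrite !inE negb_or; apply/andP; split;
        [apply: contraNneq yX => <- | apply: contraNneq t'X => <-].
    by have [E _] := cX' _ _ aX' bX' bS' ab; rewrite E eqxx in ax.
  have [|||//|a [b []]] := @k_connected3_crossing (X :\ x) z t' p x conn.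
  - by rewrite !inE px.
  - by rewrite !inE negb_or pz; apply: contraNneq t'X => <-.
  - by rewrite !inE eqxx.
  - by rewrite !inE negb_or xz' xt'.
  rewrite !inE !negb_or => /andP[ax aX] _ bP /andP[bz bt'] ab.
  have bX' : b \in X'.
    case: (nbrX _ _ aX ax ab) => [bX|bE|->] //; last by rewrite bE eqxx in bz.
    by move: bP; rewrite bX andbT negbK => /eqP->.
  have aS' : a \notin [set y; t'].
    by rewrite !inE negb_or; apply/andP; split;
      [apply: contraNneq yX => <- | apply: contraNneq t'X => <-].
  have [_ E] := cX' _ _ bX' (AX' _ aX ax) aS' (etrans (adj_sym b a) ab).
  by have := XS _ aX; rewrite E !inE eqxx.
have nbrB a b : a \notin X -> a != y -> a != z -> a != t -> adj a b ->
    [\/ [/\ b \notin X, b != z & b != t], b = z | b = t].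
  move=> aX ay az at_ ab.
  have [bz|bz] := eqVneq b z; first by constructor 2.
  have [bt|bt] := eqVneq b t; first by constructor 3.
  constructor 1; split=> //; apply/negP => bX.
  have aS : a \notin [set z; t] by rewrite !inE negb_or az.
  by have [_ E] := cX _ _ bX aX aS (etrans (adj_sym b a) ab); rewrite E eqxx in ay.
have [b0 [yb0 b0x b0z b0t]] := degree_gt3_neighbour x z t dy.
have b0X : b0 \notin X.
  apply/negP => b0X.
  by have [E _] := cX _ _ b0X yX yS (etrans (adj_sym b0 y) yb0); rewrite E eqxx in b0x.
have b0y : b0 != y by rewrite eq_sym neq.
(* The side opposite to [X], without [y]: by [nbrB], edges leave it only to [y], [z] and [t]. It
   avoids [t'] because [t'] lies in [X]. *)
pose B := ~: X :\: [set y; z; t].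
have inB u : (u \in B) = [&& u != y, u != z, u != t & u \notin X].
  by rewrite !inE !negb_or -!andbA.
have b0B : b0 \in B by rewrite inB b0y b0z b0t.
have BS' u : u \in B -> u \notin [set y; t'].
  rewrite inB !inE negb_or => /and4P[-> _ _ uX] /=.
  by apply: contraNneq uX => ->.
have BX u : u \in B -> u != x.
  by rewrite inB => /and4P[_ _ _]; apply: contraNneq => ->.
(* Otherwise [{y, t}] would separate [B :&: X'] from [z]. *)
have b0X' : b0 \notin X'.
  apply/negP => b0X'.
  have [|||//|a [b []]] := @k_connected3_crossing (B :&: X') y t b0 z conn.
  - by rewrite inE b0B.
  - by rewrite !inE negb_or b0y.
  - by rewrite inE inB eqxx andbF.
  - by rewrite !inE negb_or zy'.
  rewrite inE => /andP[aB aX'] _ bP; rewrite !inE negb_or => /andP[by_ bt] ab.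
  have ax := BX _ aB.
  have [bX' bS'] : b \notin X' /\ b \notin [set y; t'].
    move: aB; rewrite inB => /and4P[ay az at_ aX].
    case: (nbrB _ _ aX ay az at_ ab) => [[bX bz _]|->|bE] //; last first.
      by rewrite bE eqxx in bt.
    have bB : b \in B by rewrite inB by_ bz bt.
    by split; [move: bP; rewrite inE bB | exact: BS'].
  by have [E _] := cX' _ _ aX' bX' bS' ab; rewrite E eqxx in ax.
(* As [t] lies in [X'], an edge leaving [B :\: X'] and avoiding [y] and [z] ends in [X'] at a vertex
   other than [x], which the cut of [xz] forbids. *)
have [|||//|a [b []]] := @k_connected3_crossing (B :\: X') y z b0 x conn.
- by rewrite inE b0X' b0B.
- by rewrite !inE negb_or b0y.
- by rewrite inE xX'.
- by rewrite !inE negb_or xy'.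
rewrite inE => /andP[aX' aB] _ bP; rewrite !inE negb_or => /andP[by_ bz] ab.
have ba := etrans (adj_sym b a) ab.
have [bX' bx] : b \in X' /\ b != x.
  move: (aB); rewrite inB => /and4P[ay az at_ aX].
  case: (nbrB _ _ aX ay az at_ ab) => [[bX _ bt]|bE|->]; last by rewrite eq_sym.
    have bB : b \in B by rewrite inB by_ bz bt.
    by split; [move: bP; rewrite inE bB andbT negbK | exact: BX].
  by rewrite bE eqxx in bz.
by have [E _] := cX' _ _ bX' aX' (BS' _ aB) ba; rewrite E eqxx in bx.
Qed.

End Cuts.

(** * Degree bounds and edge counting *)

Section Degrees.
Variable G : sgraph.
Implicit Types (S P T : {set G}) (u v w x y z a b : G).

Lemma degreeE x : degree x = \sum_y adj x y.
Proof.
rewrite /degree -sum1_card (eq_bigl (adj x)); last by move=> y; rewrite inE.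
by rewrite big_mkcond; apply: eq_bigr => y _; case: (adj x y).
Qed.

Lemma adj_neq x y : adj x y -> x != y.
Proof. by apply: contraTneq => ->; rewrite adj_irrefl. Qed.

Lemma adjacent_degrees_le u v : minimally_k_connected 3 G ->
  adj u v -> 3 < degree u -> 3 < degree v -> degree u + degree v <= #|G|.
Proof.
move=> mini uv du dv; rewrite /degree -cardsUI.
have -> : [set y | adj u y] :&: [set y | adj v y] = set0.
  apply/setP => z; rewrite !inE; apply/negP => /andP[uz vz].
  exact: triangle_degree_le3 mini uv uz vz du dv.
by rewrite cards0 addn0 max_card.
Qed.

(** A neighbourhood of at most two vertices would itself be a set cutting [x] off from the rest. *)
Lemma degree_ge3 x : k_connected 3 G -> 3 < #|G| -> 3 <= degree x.
Proof.
move=> conn G3; rewrite leqNgt; apply/negP => dx.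
have /subsetPn[y _] : ~~ ([set: G] \subset x |: [set y | adj x y]).
  apply/negP => /subset_leq_card; rewrite cardsT cardsU1 inE adj_irrefl /= => h.
  by move: G3; rewrite ltnNge (leq_trans h).
rewrite in_setU1 negb_or => /andP[yx yN].
have [||a [b [/set1P-> _ _]]] := connected_del_crossing (conn _ dx) (set11 x) _ _ yN.
- by rewrite inE adj_irrefl.
- by rewrite inE.
by rewrite inE => /negPf->.
Qed.

(** The spanning tree bound, each edge being counted twice by the double sum. A set grows from one
    vertex along crossing edges, and every new vertex adds at least 2 to the sum. *)
Lemma connected_edge_count S : connected_graph (del_vertices S) ->
  2 * #|~: S| <= \sum_(x in ~: S) \sum_(y in ~: S) adj x y + 2.
Proof.
move=> conn.
have [r rS] : exists r, r \in ~: S.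
  by case: conn => /card_gt0P[[r rS] _] _; exists r; rewrite inE.
suff grow k : k < #|~: S| -> exists P, [/\ P \subset ~: S, #|P| = k.+1
    & 2 * #|P| <= \sum_(x in P) \sum_(y in P) adj x y + 2].
  have Sgt0 : 0 < #|~: S| by apply/card_gt0P; exists r.
  have [|P [PS Pk eP]] := grow #|~: S|.-1; first by rewrite prednK.
  suff <- : P = ~: S by [].
  by apply/eqP; rewrite eqEcard PS Pk prednK /= ?leqnn.
elim: k => [_|k IHk ltk].
  by exists [set r]; rewrite sub1set rS cards1 muln1; split=> //; rewrite leq_addl.
have [P [PS Pk eP]] := IHk (ltnW ltk).
have [x xP] : exists x, x \in P by apply/card_gt0P; rewrite Pk.
have /subsetPn[y yS yP] : ~~ (~: S \subset P).
  by apply/negP => /subset_leq_card; rewrite Pk leqNgt ltk.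
have notS z : z \in ~: S -> z \notin S by rewrite inE.
have [a [b [aP _ bP bS ab]]] :=
  connected_del_crossing conn xP (notS _ (subsetP PS _ xP)) yP (notS _ yS).
exists (b |: P); split.
- by rewrite subUset PS sub1set inE bS.
- by rewrite cardsU1 bP Pk.
rewrite cardsU1 bP big_setU1 //= big_setU1 //= adj_irrefl add0n.
rewrite [in X in _ <= _ + X + 2](eq_bigr (fun z => adj z b + \sum_(y in P) adj z y)); last first.
  by move=> z _; rewrite big_setU1.
rewrite big_split /=.
have h1 : 0 < \sum_(y in P) adj b y by rewrite (bigD1 a) //= adj_sym ab.
have h2 : 0 < \sum_(z in P) adj z b by rewrite (bigD1 a) //= ab.
lia.
Qed.

(** All vertices of [T], the neighbourhood of [v], have degree at most 3, so at most two neighbours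
    besides [v]. At least three of these [2 * #|T|] adjacencies go to [u], which leaves fewer than
    the [2 * #|T| - 2] that connectivity of [G - u - v] demands. *)
Lemma degree_neq_subn2 v : minimally_k_connected 3 G -> 5 < #|G| ->
  degree v <> #|G| - 2.
Proof.
move=> mini G5 dv; have conn := mini.1.
have dN : #|~: [set y | adj v y]| = 2 by rewrite cardsCs setCK -/(degree v) dv; lia.
have [u NE] : exists u, ~: [set y | adj v y] = [set v; u].
  by apply: set2_of_card_lt3; rewrite ?dN // !inE adj_irrefl.
have vu : v != u by move: dN; rewrite NE cards2; case: (_ != _).
have NvE x : adj v x = (x \notin [set v; u]) by rewrite -NE !inE negbK.
have conn2 : connected_graph (del_vertices [set v; u]).
  by apply: conn; rewrite cards2; case: (_ != _).
have := connected_edge_count conn2; rewrite -{1}NE setCK -/(degree v).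
set T := ~: [set v; u] => count.
have du : \sum_(x in T) adj x u = degree u.
  rewrite degreeE [RHS](bigID [pred x | x \in T]) /= [X in _ + X]big1 ?addn0.
    by apply: eq_bigr => x _; rewrite adj_sym.
  move=> x; rewrite inE negbK !inE => /orP[]/eqP->; last by rewrite adj_irrefl.
  by rewrite adj_sym NvE !inE eqxx orbT.
have du3 : 3 <= degree u by apply: degree_ge3 => //; lia.
have bound : \sum_(x in T) (\sum_(y in T) adj x y + adj x u) <= \sum_(x in T) 2.
  apply: leq_sum => x; rewrite inE => xT; have vx : adj v x by rewrite NvE.
  have dx : degree x <= 3.
    rewrite leqNgt; apply/negP => dx.
    by have := adjacent_degrees_le mini vx _ dx; lia.
  move: dx; rewrite degreeE (bigID [pred y | y \in T]) /=.
  rewrite [X in _ + X](eq_bigl [pred y | y \in [set v; u]]) /=; last by move=> y; rewrite /= /T in_setC negbK.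
  by rewrite [X in _ + X]big_setU1 ?inE //= big_set1 adj_sym vx; lia.
move: bound; rewrite big_split /= du sum_nat_const.
have -> : #|T| = degree v by rewrite /T -NE setCK.
lia.
Qed.

End Degrees.

(** * Cycles, and the wheel around a universal vertex *)

Lemma ordSS_neq m (i : 'I_m) : 2 < m -> ordS (ordS i) != i.
Proof.
move=> m2; apply/eqP => /(congr1 val) /=; have im := ltn_ord i.
have [E|ne] := eqVneq i.+1 m; first by rewrite E modnn modn_small; lia.
rewrite (@modn_small i.+1); last by lia.
have [E|ne'] := eqVneq i.+2 m; first by rewrite E modnn; lia.
by rewrite modn_small; lia.
Qed.

Lemma card_cycle_adj m (i : 'I_m) : 2 < m -> #|[set j | cycle_adj i j]| = 2.
Proof.
move=> m2; have iS : i != ordS i.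
  apply/eqP => /(congr1 val) /=; have im := ltn_ord i.
  have [E|ne] := eqVneq i.+1 m; first by rewrite E modnn; lia.
  by rewrite modn_small; lia.
have -> : [set j | cycle_adj i j] = [set ordS i; ord_pred i].
  apply/setP => j; rewrite !inE /cycle_adj.
  have -> : (i == ordS j) = (j == ord_pred i).
    by apply/eqP/eqP => ->; rewrite ?ordSK ?ord_predK.
  case: eqVneq => [<-|//] /=; rewrite (negPf iS) /=; apply/esym/negbTE.
  by apply: contra iS => /eqP {2}->; rewrite ord_predK.
rewrite cards2; have := ordSS_neq (ord_pred i) m2; rewrite ord_predK.
by move=> ->.
Qed.

Section Wheel.
Variables (G : sgraph) (v : G).
Hypothesis mini : minimally_k_connected 3 G.
Hypothesis order_ge6 : 5 < #|G|.
Hypothesis dv : degree v = #|G|.-1.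

Let hub x : x != v -> adj v x.
Proof.
move=> xv; suff -> : adj v x = (x \in [set~ v]) by rewrite !inE.
suff <- : [set y | adj v y] = [set~ v] by rewrite inE.
apply/eqP; rewrite eqEcard -/(degree v) dv cardsCs setCK cards1 subn1 leqnn andbT.
by apply/subsetP => y; rewrite !inE eq_sym; apply: adj_neq.
Qed.

Let rim_degree x : x != v -> degree x = 3.
Proof.
move=> xv; apply/eqP; rewrite eqn_leq; apply/andP; split; last first.
  by apply: (degree_ge3 _ mini.1); lia.
rewrite leqNgt; apply/negP => dx.
by have := adjacent_degrees_le mini (hub xv) _ dx; lia.
Qed.

(** The hub takes one of the three neighbours of [x]. *)
Let rim_third x a b c : x != v -> adj x a -> adj x b -> adj x c ->
  a != v -> b != v -> c != v -> ~~ uniq [:: a; b; c].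
Proof.
move=> xv xa xb xc av bv cv; apply/negP => abc.
have := rim_degree xv; rewrite /degree.
have : uniq [:: v; a; b; c] by rewrite cons_uniq abc !inE !negb_or eq_sym av eq_sym bv eq_sym cv.
move=> /card_uniqP card4.
have : [:: v; a; b; c] \subset [set y | adj x y].
  apply/subsetP => y; rewrite !inE => /or4P[]/eqP-> //.
  by rewrite adj_sym hub.
by move/subset_leq_card; rewrite card4 /= => h e; rewrite e in h.
Qed.

(** While the path misses a rim vertex, connectivity of [G - v] gives an edge leaving it. An inner
    vertex already has its two rim neighbours on the path, so this edge starts at an end and
    prolongs the path. *)
Let rim_path k : k < #|G|.-1 ->
  exists s : seq G, [/\ size s = k.+1, uniq s, v \notin s & sorted adj s].
Proof.
elim: k => [_|k IHk ltk].
  have /card_gt0P[x] : 0 < #|[set~ v]| by rewrite cardsCs setCK cards1; lia.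
  by rewrite !inE => xv; exists [:: x]; rewrite /= inE eq_sym.
have [s [sk us vs ps]] := IHk (ltnW ltk).
have connv : connected_graph (del_vertices [set v]) by apply: mini.1; rewrite cards1.
have [x xs] : exists x, x \in s by case: s sk {us vs ps} => // x s _; exists x; rewrite inE eqxx.
have xv : x != v by apply: contraNneq vs => <-.
have /subsetPn[y] : ~~ ([set~ v] \subset s).
  apply/negP => /subset_leq_card; rewrite cardsCs setCK cards1 (card_uniqP us) sk.
  by lia.
rewrite !inE => yv ys.
have [||||a [b []]] := @connected_del_crossing G [set v] [set z in s] x y connv; rewrite ?inE //.
move=> as_ av bs bv ab.
have nthv i : i < size s -> nth v s i != v.
  by move=> iS; apply: contraNneq vs => <-; apply: mem_nth.
have [i ltS aE] : exists2 i, i < size s & nth v s i = a.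
  by exists (index a s); rewrite ?index_mem ?nth_index.
have adjS j : j.+1 < size s -> adj (nth v s j) (nth v s j.+1) by apply/sortedP.
have [i0|ipos] := posnP i.
  exists (b :: s); rewrite /= sk us bs inE negb_or eq_sym bv vs; split=> //.
  rewrite {}i0 in aE; case: s aE ps sk {IHk xs us vs ys as_ bs nthv adjS ltS} => //= c s ->.
  by rewrite adj_sym ab.
have [il|il] := eqVneq i (size s).-1.
  exists (rcons s b); rewrite size_rcons sk rcons_uniq us bs mem_rcons inE negb_or eq_sym bv vs.
  rewrite {}il nth_last in aE; split=> //.
  case: s aE ps sk {IHk xs us vs ys as_ bs nthv adjS ltS} => //= c s lE ps _.
  by rewrite rcons_path ps lE.
exfalso; have i1 : i.+1 < size s by lia.
have := @rim_third a (nth v s i.-1) (nth v s i.+1) b av.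
rewrite -aE in ab *.
move=> /(_ _ (adjS _ i1) ab); rewrite adj_sym -{2}(prednK ipos).
rewrite adjS ?prednK // => /(_ isT (nthv _ _) (nthv _ i1) bv).
have ip : i.-1 < size s by lia.
have nb j : j < size s -> (nth v s j == b) = false.
  by move=> js; apply: contraNF bs => /eqP <-; apply: mem_nth.
move=> /(_ ip); rewrite /= !inE !nb // nth_uniq // !orbF /= !andbT.
by rewrite negbK => /eqP; lia.
Qed.

Lemma universal_vertex_wheel : isomorphic G (wheel #|G|).
Proof.
set m := #|G|.-1.
have [|s [sm us vs ps]] := @rim_path m.-1; first by rewrite /m; lia.
have {}sm : size s = m by rewrite sm /m; lia.
have m5 : 5 <= m by rewrite /m; lia.
have ins x : x != v -> x \in s.
  move=> xv; have sub : s \subset [set~ v].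
    by apply/subsetP => y ys; rewrite !inE; apply: contraNneq vs => <-.
  suff -> : x \in s = (x \in [set~ v]) by rewrite !inE.
  apply: (subset_cardP _ sub).
  by rewrite (card_uniqP us) sm cardsCs setCK cards1 subn1.
pose c i := nth v s i.
have cv i : i < m -> c i != v.
  by move=> im; apply: contraNneq vs => <-; apply: mem_nth; rewrite sm.
have c_inj i j : i < m -> j < m -> (c i == c j) = (i == j).
  by move=> im jm; rewrite nth_uniq ?sm.
have cS i : i.+1 < m -> adj (c i) (c i.+1).
  by move=> im; apply: (sortedP v ps); rewrite sm.
(* The rim neighbour [w] of [c 0] other than [c 1] is the last vertex of the path: an inner one
   would be adjacent to both its path neighbours and to [c 0]. *)
have closing : adj (c m.-1) (c 0).
  have c0v : c 0 != v by apply: cv; lia.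
  have /subsetPn[w] : ~~ ([set y | adj (c 0) y] \subset [set v; c 1]).
    apply/negP => /subset_leq_card; rewrite -/(degree _) rim_degree //.
    by rewrite cards2; case: (_ != _).
  rewrite !inE negb_or => aw /andP[wv w1].
  have wE : c (index w s) = w by apply: nth_index; apply: ins.
  have := ins _ wv; rewrite -index_mem sm; move: wE; set j := index w s => wE jm.
  have j0 : j != 0 by apply: contraTneq aw => j0; rewrite -wE j0 adj_irrefl.
  have j1 : j != 1 by apply: contraNneq w1 => j1; rewrite -wE j1.
  have [<-|jl] := eqVneq j m.-1; first by rewrite wE adj_sym.
  have jS : j.+1 < m by lia.
  have jP : j.-1.+1 = j by lia.
  have := @rim_third w (c j.-1) (c j.+1) (c 0) wv.
  rewrite adj_sym -wE -{2}jP cS ?jP // cS // adj_sym wE aw !cv; try lia.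
  move=> /(_ isT isT isT isT isT isT).
  rewrite /= !inE !c_inj; try lia.
have cyc (i : 'I_m) : adj (c i) (c (ordS i)).
  rewrite /=; have [E|im] := eqVneq i.+1 m; first by rewrite E modnn -[i : nat]/(i.+1.-1) E.
  have im' : i.+1 < m by have := ltn_ord i; lia.
  by rewrite modn_small // cS.
have cuniq (i j k : 'I_m) : uniq [:: c i; c j; c k] = [&& i != j, i != k & j != k].
  by rewrite /= !inE !c_inj // negb_or !val_eqE !andbT -andbA.
(* A chord would give [c i] a third rim neighbour beside its cyclic successor and predecessor. *)
have adjc (i j : 'I_m) : adj (c i) (c j) = cycle_adj i j.
  apply/idP/idP => [cij|].
    have ij : i != j by apply: contraTneq cij => ->; rewrite adj_irrefl.
    rewrite /cycle_adj ij /=; apply: contraT; rewrite negb_or => /andP[jS iS].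
    have := @rim_third (c i) (c j) (c (ordS i)) (c (ord_pred i)) (cv _ (ltn_ord _)) cij (cyc _).
    have := cyc (ord_pred i); rewrite ord_predK adj_sym => -> /(_ isT).
    rewrite !cv // => /(_ isT isT isT).
    have jp : j != ord_pred i by apply: contraNneq iS => ->; rewrite ord_predK.
    rewrite cuniq jS jp /= negbK => /eqP E.
    by have := ordSS_neq (ord_pred i) (ltnW (ltnW m5)); rewrite ord_predK E eqxx.
  rewrite /cycle_adj => /andP[_ /orP[]/eqP->]; first exact: cyc.
  by rewrite adj_sym; apply: cyc.
pose g (w : wheel #|G|) : G := match w with inl _ => v | inr i => c i end.
have g_inj : injective g.
  move=> [i|i] [j|j] /=.
  - by rewrite !ord1.
  - by move=> E; have := cv j (ltn_ord j); rewrite -E eqxx.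
  - by move=> E; have := cv i (ltn_ord i); rewrite E eqxx.
  by move=> /eqP; rewrite c_inj // => /eqP/val_inj->.
have g_adj x y : adj (g x) (g y) = adj x y.
  case: x y => [i|i] [j|j] /=; first by rewrite adj_irrefl !ord1.
  - by rewrite hub // cv.
  - by rewrite adj_sym hub // cv.
  exact: adjc.
have [|f gK fK] := inj_card_bij g_inj; first by rewrite card_wheel //; lia.
by exists f => [|x y]; [exists g | rewrite -g_adj !fK].
Qed.

End Wheel.

Local Open Scope ring_scope.

(** * Eigenvalues of [alpha_mx]: upper bound from degrees, lower bound for the wheel *)

Section Spectrum.
Variables (R : realType) (alpha : R).

(** The eigenvector equation read vertex by vertex. Functions on vertices avoid the enumeration of
    [G] and pull back along isomorphisms. *)
Definition alpha_eigenfun (G : sgraph) (r : R) (f : G -> R) : Prop :=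
  forall x, alpha * (degree x)%:R * f x + (1 - alpha) * (\sum_(y | adj x y) f y)
    = r * f x.

Lemma row_mul_alpha_mx (G : sgraph) (f : G -> R) :
  (\row_i f (enum_val i)) *m alpha_mx alpha G =
  \row_i (alpha * (degree (enum_val i))%:R * f (enum_val i)
          + (1 - alpha) * \sum_(y | adj (enum_val i) y) f y).
Proof.
apply/rowP => j; rewrite !mxE.
under eq_bigr do rewrite !mxE mulrDr.
rewrite big_split /=; congr (_ + _).
  rewrite (bigD1 j) //= eqxx mulr1n big1 ?addr0 => [|i /negPf->].
    by rewrite mulrC.
  by rewrite mulr0n mulr0 mulr0.
rewrite mulr_sumr [RHS]big_mkcond /= (big_enum_val (A := G)
  (fun y => if adj (enum_val j) y then (1 - alpha) * f y else 0)) /=.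
apply: eq_bigr => i _; rewrite adj_sym; case: ifP => _.
  by rewrite mulr1 mulrC.
by rewrite !mulr0.
Qed.

Lemma alpha_eigenvalueP (G : sgraph) (r : R) :
  eigenvalue (alpha_mx alpha G) r <->
  exists2 f : G -> R, exists x, f x != 0 & alpha_eigenfun r f.
Proof.
split=> [/eigenvalueP[v vA v0]|[f [x fx] fA]].
  pose f x := v 0 (enum_rank x).
  have vE : v = \row_i f (enum_val i) by apply/rowP => i; rewrite mxE /f enum_valK.
  exists f.
    by have /rV0Pn[j vj] := v0; exists (enum_val j); rewrite /f enum_valK.
  move=> x; have := vA; rewrite {1}vE row_mul_alpha_mx => /rowP/(_ (enum_rank x)).
  by rewrite !mxE enum_rankK.
apply/eigenvalueP; exists (\row_i f (enum_val i)).
  by rewrite row_mul_alpha_mx; apply/rowP => i; rewrite !mxE fA.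
by apply/rV0Pn; exists (enum_rank x); rewrite mxE enum_rankK.
Qed.

Lemma isomorphic_eigenvalue (G H : sgraph) (r : R) : isomorphic G H ->
  eigenvalue (alpha_mx alpha H) r -> eigenvalue (alpha_mx alpha G) r.
Proof.
move=> [h [g hK gK] hadj] /alpha_eigenvalueP[f [x fx] fA].
apply/alpha_eigenvalueP; exists (f \o h); first by exists (g x); rewrite /= gK.
have reidx (F : H -> R) z : \sum_(y | adj (h z) y) F y = \sum_(y | adj z y) F (h y).
  rewrite (reindex h) /=; last by exists g => ? _.
  by apply: eq_bigl => y; rewrite hadj.
move=> z; rewrite -reidx; rewrite -(fA (h z)); congr (_ * _%:R * _ + _).
rewrite !degreeE (reindex h) /=; last by exists g => ? _.
by apply: eq_bigr => y _; rewrite hadj.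
Qed.

Lemma isomorphic_alpha_index (G H : sgraph) : (0 < #|G|)%N -> isomorphic G H ->
  alpha_index alpha G = alpha_index alpha H.
Proof.
move=> G0 iso; have [h [g hK gK] hadj] := iso.
have iso' : isomorphic H G.
  by exists g => [|x y]; [exists h | rewrite -hadj !gK].
have H0 : (0 < #|H|)%N by have /card_gt0P[x _] := G0; apply/card_gt0P; exists (h x).
have [eG mG] := alpha_indexP alpha G0; have [eH mH] := alpha_indexP alpha H0.
apply/eqP; rewrite eq_le; apply/andP; split; [apply: mH | apply: mG].
  exact: isomorphic_eigenvalue iso' eG.
exact: isomorphic_eigenvalue iso eH.
Qed.

Hypotheses (alpha_ge : 2^-1 <= alpha) (alpha_lt1 : alpha < 1).

(* On edges, [w x y = f x + f y] satisfies
   [(r - (2 alpha - 1) d x) f x = (1 - alpha) * \sum_(y ~ x) w x y],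
   so a maximal [|w|] bounds [r]. *)
Lemma alpha_eigenvalue_le (G : sgraph) (k m : nat) (r : R) :
  (forall x : G, degree x <= k)%N ->
  (forall x y : G, adj x y -> degree x + degree y <= m)%N ->
  eigenvalue (alpha_mx alpha G) r ->
  r <= (2 * alpha - 1) * k%:R + (1 - alpha) * m%:R.
Proof.
move=> degk degm /alpha_eigenvalueP[f [x0 fx0] fA].
rewrite leNgt; apply/negP => ltr.
set c := r - (2 * alpha - 1) * k%:R.
have beta_gt0 : 0 < 1 - alpha by rewrite subr_gt0.
have ge0 : 0 <= 2 * alpha - 1 by rewrite subr_ge0 -ler_pdivrMl ?mulr1.
have ltc : (1 - alpha) * m%:R < c by rewrite /c ltrBrDl.
have c_gt0 : 0 < c.
  by apply: le_lt_trans ltc; rewrite mulr_ge0 ?ler0n // ltW.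
pose M := \big[Num.max/0]_(p : G * G | adj p.1 p.2) `|f p.1 + f p.2|.
have leM x y : adj x y -> `|f x + f y| <= M.
  by move=> xy; apply: (@le_bigmax_cond _ _ _ _ (x, y) (fun p => adj p.1 p.2)
    (fun p => `|f p.1 + f p.2|)).
have M_ge0 : 0 <= M by apply: bigmax_ge_id.
have fle x : c * `|f x| <= (1 - alpha) * (degree x)%:R * M.
  have E : (r - (2 * alpha - 1) * (degree x)%:R) * f x
      = (1 - alpha) * \sum_(y | adj x y) (f x + f y).
    rewrite big_split /= sumr_const mulrBl -fA.
    have -> : #|[pred y | adj x y]| = degree x by rewrite /degree cardsE.
    rewrite -mulr_natr; ring.
  (* As [2 * alpha - 1] is nonnegative, replacing the degree by [k] only lowers the factor of [f x],
     down to [c]. *)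
  have dle : (2 * alpha - 1) * (degree x)%:R <= (2 * alpha - 1) * k%:R.
    by rewrite ler_wpM2l // ler_nat.
  have cle : c <= r - (2 * alpha - 1) * (degree x)%:R by rewrite /c lerB.
  have := congr1 Num.norm E; rewrite !normrM (gtr0_norm (lt_le_trans c_gt0 cle)).
  rewrite (gtr0_norm beta_gt0) => E'.
  apply: (@le_trans _ _ ((r - (2 * alpha - 1) * (degree x)%:R) * `|f x|)).
    by rewrite ler_wpM2r.
  rewrite E' -mulrA ler_wpM2l ?(ltW beta_gt0) //.
  apply: (le_trans (ler_norm_sum _ _ _)).
  apply: (@le_trans _ _ (\sum_(y | adj x y) M)); first by apply: ler_sum => y; apply: leM.
  by rewrite sumr_const /degree cardsE mulr_natl.
(* Adding [fle] over both ends of an edge gives [c * M <= (1 - alpha) * m * M], while [c] exceeds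
   [(1 - alpha) * m]. Once [M = 0], [fle] makes [f] vanish. *)
have M0 : M = 0.
  apply/le_anti; rewrite M_ge0 andbT leNgt; apply/negP => M_gt0.
  suff : M <= (1 - alpha) * m%:R * M / c.
    rewrite ler_pdivlMr // mulrC ler_pM2r // => cle.
    by have := lt_le_trans ltc cle; rewrite ltxx.
  apply: bigmax_le => [|[x y] /= xy].
    by rewrite !mulr_ge0 ?invr_ge0 ?ler0n // ltW.
  rewrite ler_pdivlMr // mulrC.
  apply: (@le_trans _ _ (c * (`|f x| + `|f y|))).
    by rewrite ler_pM2l // ler_normD.
  rewrite mulrDr; apply: (le_trans (lerD (fle x) (fle y))).
  rewrite -mulrDl -mulrDr -natrD ler_wpM2r // ler_wpM2l ?(ltW beta_gt0) // ler_nat.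
  exact: degm.
have := fle x0; rewrite M0 mulr0 => /le_gtF/negP; apply.
by rewrite mulr_gt0 // normr_gt0.
Qed.

(** By hypothesis the characteristic quadratic of the hub-rim quotient is negative at [t], so [t] is
    below its larger root [l]. An eigenvector of the quotient lifts to the wheel as a function
    constant on the rim. *)
Lemma alpha_index_wheel_gt (n : nat) (t : R) : (3 < n)%N ->
  (t - alpha * (n%:R - 1)) * (t - alpha - 2) < (1 - alpha) ^+ 2 * (n%:R - 1) ->
  t < alpha_index alpha (wheel n).
Proof.
move=> n3 ht; have n0 : (0 < n)%N by lia.
have W0 : (0 < #|wheel n|)%N by rewrite card_wheel.
have N1 : (n.-1)%:R = n%:R - 1 :> R by rewrite -{2}(prednK n0) -natr1 addrK.
set N : R := n%:R - 1 in ht N1.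
have N_ge0 : 0 <= N by rewrite -N1 ler0n.
pose s := Num.sqrt ((alpha * N - (alpha + 2)) ^+ 2 + 4 * ((1 - alpha) ^+ 2 * N)).
have s_ge0 : 0 <= s by apply: sqrtr_ge0.
have sE : s ^+ 2 = (alpha * N - (alpha + 2)) ^+ 2 + 4 * ((1 - alpha) ^+ 2 * N).
  by rewrite sqr_sqrtr // addr_ge0 ?sqr_ge0 // mulr_ge0 // mulr_ge0 // sqr_ge0.
(* The diagonal of the quotient is [alpha * N] for the hub and
   [3 * alpha + 2 * (1 - alpha) = alpha + 2] for the rim. *)
pose l := (alpha * N + (alpha + 2) + s) / 2.
have lE : (l - alpha * N) * (l - alpha - 2) = (1 - alpha) ^+ 2 * N.
  have -> : (l - alpha * N) * (l - alpha - 2)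
      = (s ^+ 2 - (alpha * N - (alpha + 2)) ^+ 2) / 4 by rewrite /l; field.
  by rewrite sE; field.
have ltl : t < l.
  rewrite ltNge; apply/negP => lt.
  have h1 : s <= 2 * t - (alpha * N + (alpha + 2)) by move: lt; rewrite /l; lra.
  have h2 : s ^+ 2 <= (2 * t - (alpha * N + (alpha + 2))) ^+ 2.
    by rewrite lerXn2r ?nnegrE // (le_trans s_ge0).
  by rewrite sE in h2; nra.
have [_ maxW] := alpha_indexP alpha W0.
apply: (lt_le_trans ltl); apply: maxW; apply/alpha_eigenvalueP.
(* These two values solve the rim equation identically; the hub equation is then [lE]. *)
pose g (w : wheel n) : R := match w with inl _ => l - alpha - 2 | inr _ => 1 - alpha end.
have card_rim (i : 'I_n.-1) : #|[pred j | cycle_adj i j]| = 2%N.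
  by rewrite -(@card_cycle_adj _ i) ?cardsE //; lia.
exists g.
  have n1 : (0 < n.-1)%N by lia.
  by exists (inr (Ordinal n1)); rewrite /g subr_eq0 gt_eqF.
move=> [i|i].
  have -> : degree (inl i : wheel n) = n.-1.
    rewrite degreeE big_sumType /= big_ord1 /complete_adj !ord1 /= add0n.
    by rewrite sum_nat_const card_ord muln1.
  rewrite big_mkcond big_sumType /= big_ord1 /complete_adj !ord1 /= add0r.
  rewrite sumr_const card_ord -[(1 - alpha) *+ _]mulr_natr N1 /g.
  have -> : (1 - alpha) * ((1 - alpha) * N) = (1 - alpha) ^+ 2 * N by ring.
  by rewrite -lE; ring.
have -> : degree (inr i : wheel n) = 3%N.
  rewrite degreeE big_sumType /= big_ord1 /=.
  have -> : (\sum_j adj i j = \sum_(j | cycle_adj i j) 1)%N.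
    by rewrite [RHS]big_mkcond; apply: eq_bigr => j _; rewrite /adj /=; case: cycle_adj.
  by rewrite sum1_card card_rim.
rewrite big_mkcond big_sumType /= big_ord1 /=.
have -> : \sum_(j : 'I_n.-1) (if adj i j then 1 - alpha else 0) = (1 - alpha) *+ 2.
  by rewrite -big_mkcond sumr_const card_rim.
ring.
Qed.

End Spectrum.

(** * Comparison with the wheel according to the maximum degree *)

Theorem theorem1p2 (R : realType) (alpha : R) (n : nat) (G : sgraph)
    (order_G : #|G| = n) (n_ge7 : (7 <= n)%N)
    (G_min3conn : minimally_k_connected 3 G)
    (alpha_ge : 2^-1 <= alpha) (alpha_lt1 : alpha < 1) :
  alpha_index alpha G <= alpha_index alpha (wheel n) /\
  (alpha_index alpha G = alpha_index alpha (wheel n) <->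
   isomorphic G (wheel n)).
Proof.
have G0 : (0 < #|G|)%N by lia.
have iso_eq : isomorphic G (wheel n) -> alpha_index alpha G = alpha_index alpha (wheel n).
  exact: isomorphic_alpha_index.
case: (boolP [forall x : G, (degree x <= n - 3)%N]) => [/forallP degle|].
  suff lt : alpha_index alpha G < alpha_index alpha (wheel n).
    split; first exact: ltW.
    by split=> // E; rewrite E ltxx in lt.
  have [eG _] := alpha_indexP alpha G0.
  (* If one end has degree at most 3, the bound [n - 3] on the other suffices. *)
  have degD (x y : G) : adj x y -> (degree x + degree y <= n)%N.
    move=> xy; have := degle x; have := degle y => dy dx.
    have [dx3|dx3] := leqP (degree x) 3; first by lia.
    have [dy3|dy3] := leqP (degree y) 3; first by lia.
    by rewrite -order_G; apply: adjacent_degrees_le.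
  apply: le_lt_trans (alpha_eigenvalue_le alpha_ge alpha_lt1 degle degD eG) _.
  apply: alpha_index_wheel_gt => //; first by lia.
  rewrite natrB; last by lia.
  have : 7 <= n%:R :> R by rewrite ler_nat.
  move: (n%:R : R) => N N7.
  have ge0 : 0 <= 2 * alpha - 1 by rewrite subr_ge0 -ler_pdivrMl ?mulr1.
  (* The right side minus the left side is affine in [N], with slope
     [(2 * alpha - 1) * (3 * alpha - 1)] and value [6 * alpha ^+ 2 - 7 * alpha + 3] at [N = 7]; this
     last quadratic has negative discriminant. *)
  have h : 0 <= (N - 7) * ((2 * alpha - 1) * (3 * alpha - 1)).
    by rewrite !mulr_ge0 //; lra.
  have h2 : 0 < 6 * alpha ^+ 2 - 7 * alpha + 3 by nra.
  nra.
(* Now [degree v] is at least [n - 2]; excluding [n - 2] and using [degree v < n] leaves [n - 1]. *)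
rewrite negb_forall => /existsP[v]; rewrite -ltnNge => dv.
have dv1 : (degree v < #|G|)%N.
  by rewrite -cardsT; apply: proper_card; apply/properP; split;
    [exact: subsetT | exists v; rewrite !inE // adj_irrefl].
have dv2 : degree v <> (#|G| - 2)%N by apply: degree_neq_subn2 => //; lia.
have iso : isomorphic G (wheel n).
  by rewrite -order_G; apply: (@universal_vertex_wheel _ v) => //; lia.
by rewrite iso_eq.
Qed.
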